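(* Let $m$ be any even number of machines and consider any distributed optimization algorithm satisfying Assumption 1 (non-smooth version). Let $\lambda\ge0$. Then, for $d$ sufficiently large, there exist two convex functions $F_1,F_2$ on the unit Euclidean ball $\{\mathbf w\in\mathbb R^d:\|\mathbf w\|\le1\}$ with the following properties: - each is $\lambda$-strongly convex and $(1+\lambda)$-Lipschitz; - if $m/2$ machines hold $F_1$ and $m/2$ hold $F_2$, set $F=\frac12(F_1+F_2)$ and $\mathbf w^*=\arg\min_{\|\mathbf w\|\le1}F(\mathbf w)$. Then, for every sufficiently small $\epsilon>0$, the number of communication rounds required to obtain $\hat{\mathbf w}$ with $F(\hat{\mathbf w})-F(\mathbf w^* )\le\epsilon$ is at least $\frac{1}{8\epsilon}-2$ if $\lambda=0$, and at least $\sqrt{\frac{1}{16\lambda\epsilon}}-2$ if $\lambda>0$.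
   Context: Distributed model: there are $m$ machines; machine $i$ holds a convex function $F_i$, and the goal is to minimize the average $F=\frac1m\sum_iF_i$. The algorithm proceeds in rounds. In each round every machine performs arbitrary (unbounded) local computation. This is followed by a communication round in which each machine broadcasts a message to all other machines. After the last communication round, a designated machine outputs a point $\hat{\mathbf w}$. Assumption 1 (non-smooth version): Each machine $j$ maintains a set $W_j\subset\mathbb R^d$, initially $W_j=\{\mathbf 0\}$. Between communication rounds, machine $j$ may iteratively add to $W_j$ finitely many points $\mathbf w$. Each such point must satisfy, for some subgradient $\mathbf g\in\partial F_j(\mathbf w)$ and some $\gamma,\nu\ge0$ with $\gamma+\nu>0$, $$\gamma\mathbf w+\nu\mathbf g\in\operatorname{span}\{\mathbf w',\ \mathbf g',\ (\nabla^2F_j(\mathbf w')+D)\mathbf w'',\ (\nabla^2F_j(\mathbf w')+D)^{-1}\mathbf w''\},$$ where the span ranges over $\mathbf w',\mathbf w''\in W_j$, subgradients $\mathbf g'\in\partial F_j(\mathbf w')$, and diagonal matrices $D$ such that $\nabla^2F_j(\mathbf w')$ and $(\nabla^2F_j(\mathbf w')+D)^{-1}$ exist. After every communication round, every $W_j$ is replaced by $\bigcup_{i=1}^mW_i$. The final output of the designated machine $j$ is a point in $\operatorname{span}W_j$.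
   Formalization: The dimension d and the functions F_1, F_2 may depend on ε: ε is fixed first, then d is taken sufficiently large. With d, F_1, F_2 fixed before ε the claim fails, since about d rounds suffice to reach an exact minimizer. *)

(* Defs.v *)
From Stdlib Require Import Reals List.
From mathcomp Require Import all_boot.
Set Implicit Arguments. Unset Strict Implicit. Unset Printing Implicit Defensive.

Local Open Scope R_scope.

Definition vec (d : nat) := 'I_d -> R.
Definition mat (d : nat) := 'I_d -> 'I_d -> R.

Definition rsum (d : nat) (f : 'I_d -> R) : R := \big[Rplus/R0]_(i < d) f i.

Definition vzero (d : nat) : vec d := fun _ => R0.
Definition vadd d (u v : vec d) : vec d := fun i => u i + v i.
Definition vscale d (a : R) (u : vec d) : vec d := fun i => a * u i.
Definition vsub d (u v : vec d) : vec d := fun i => u i - v i.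
Definition dot d (u v : vec d) : R := rsum (fun i => u i * v i).
Definition norm d (u : vec d) : R := sqrt (dot u u).

Definition mulmv d (M : mat d) (v : vec d) : vec d :=
  fun i => rsum (fun j => M i j * v j).
Definition mmul d (M N : mat d) : mat d :=
  fun i k => rsum (fun j => M i j * N j k).
Definition madd d (M N : mat d) : mat d := fun i j => M i j + N i j.
Definition idm (d : nat) : mat d := fun i j => if i == j then R1 else R0.
Definition diagonal d (D : mat d) : Prop := forall i j, i <> j -> D i j = 0.
Definition inverse_of d (M N : mat d) : Prop := mmul M N = @idm d /\ mmul N M = @idm d.

Definition in_ball d (w : vec d) : Prop := norm w <= 1.

Definition lincomb d (l : list (R * vec d)) : vec d :=
  fold_right (fun p acc => vadd (vscale (fst p) (snd p)) acc) (@vzero d) l.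
Definition span_of d (S : vec d -> Prop) (v : vec d) : Prop :=
  exists l : list (R * vec d), (forall p, In p l -> S (snd p)) /\ v = lincomb l.

Definition convex_on_ball d (F : vec d -> R) : Prop :=
  forall u v t, in_ball u -> in_ball v -> 0 <= t <= 1 ->
    F (vadd (vscale t u) (vscale (1 - t) v)) <= t * F u + (1 - t) * F v.

Definition strongly_convex_on_ball d (lam : R) (F : vec d -> R) : Prop :=
  forall u v t, in_ball u -> in_ball v -> 0 <= t <= 1 ->
    F (vadd (vscale t u) (vscale (1 - t) v))
      <= t * F u + (1 - t) * F v - lam / 2 * t * (1 - t) * (norm (vsub u v))^2.

Definition lipschitz_on_ball d (L : R) (F : vec d -> R) : Prop :=
  forall u v, in_ball u -> in_ball v -> Rabs (F u - F v) <= L * norm (vsub u v).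

Definition subgrad d (F : vec d -> R) (w g : vec d) : Prop :=
  in_ball w /\ forall u, in_ball u -> F w + dot g (vsub u w) <= F u.

Definition has_gradient d (F : vec d -> R) (w g : vec d) : Prop :=
  forall e, 0 < e -> exists del, 0 < del /\ forall u, norm (vsub u w) < del ->
    Rabs (F u - F w - dot g (vsub u w)) <= e * norm (vsub u w).

Definition has_hessian d (F : vec d -> R) (w : vec d) (H : mat d) : Prop :=
  exists (G : vec d -> vec d) (r : R), 0 < r /\
    (forall u, norm (vsub u w) < r -> in_ball u) /\
    (forall u, norm (vsub u w) < r -> has_gradient F u (G u)) /\
    (forall e, 0 < e -> exists del, 0 < del /\ forall u, norm (vsub u w) < del ->
       norm (vsub (vsub (G u) (G w)) (mulmv H (vsub u w))) <= e * norm (vsub u w)).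

Definition gen d (F : vec d -> R) (W : list (vec d)) (v : vec d) : Prop :=
  In v W \/
  (exists w', In w' W /\ subgrad F w' v) \/
  (exists w' w'' H D N, In w' W /\ In w'' W /\ has_hessian F w' H /\ diagonal D /\
      inverse_of (madd H D) N /\ v = mulmv (madd H D) w'') \/
  (exists w' w'' H D N, In w' W /\ In w'' W /\ has_hessian F w' H /\ diagonal D /\
      inverse_of (madd H D) N /\ v = mulmv N w'').

Definition can_add d (F : vec d -> R) (W : list (vec d)) (w : vec d) : Prop :=
  exists (g : vec d) (gam nu : R), subgrad F w g /\ 0 <= gam /\ 0 <= nu /\
    0 < gam + nu /\ span_of (gen F W) (vadd (vscale gam w) (vscale nu g)).

Inductive local_reach d (F : vec d -> R) : list (vec d) -> list (vec d) -> Prop :=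
| lr_refl W : local_reach F W W
| lr_step W W' w : local_reach F W W' -> can_add F W' w -> local_reach F W (w :: W').

(* reach Fs T S : S (machine -> its set W_j) is a possible state right after
   the T-th communication round, when machine i holds Fs i. *)
Inductive reach d m (Fs : 'I_m -> vec d -> R) : nat -> ('I_m -> list (vec d)) -> Prop :=
| reach0 : reach Fs 0 (fun _ => @vzero d :: nil)
| reachS T S S' : reach Fs T S -> (forall j, local_reach (Fs j) (S j) (S' j)) ->
    reach Fs T.+1 (fun _ => flatten [seq S' j | j <- enum 'I_m]).

(* Main.v *)
(* For a parity [p], let [F_p] be the sum of smoothed absolute values of
   [w_i - w_(i+1)] over the [i] of parity [p] with [i + 1 < n], plus a quadratic
   regularizer and, for odd parity, a linear term [- c w_0].  The terms of [F_p]
   involve disjoint pairs of coordinates, so local computation extends the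
   common support [{0, ..., T - 1}] of the known points by at most one
   coordinate, and after [T] rounds all points are supported on the first [T]
   coordinates.  If [w_(n-1) = 0], the chain terms telescope to at least [w_0],
   so [F_0 + F_1] is nonnegative, whereas it is negative at a suitable vector
   that is constant on the first [n] coordinates.

   The absolute value must be smoothed because its subdifferential at [0]
   would reveal all pairs at once, and the regularizer is needed even for
   [lam = 0]: without it, every point that is constant on the pairs has its
   gradient in the known span, and could be added at once. *)
From HB Require Import structures.
Require Import Defs.
From Stdlib Require Import Reals List Lra Lia ZArith ClassicalEpsilon FunctionalExtensionality.
From mathcomp Require Import all_boot.

Set Implicit Arguments.
Unset Strict Implicit.
Unset Printing Implicit Defensive.

Local Open Scope R_scope.

(** * Finite real sums over coordinates *)

Fact RplusA : associative Rplus.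
Proof. by move=> x y z; ring. Qed.

Fact RplusC : commutative Rplus.
Proof. by move=> x y; ring. Qed.

Fact Rplus0l : left_id R0 Rplus.
Proof. by move=> x; ring. Qed.

HB.instance Definition _ :=
  Monoid.isComLaw.Build R R0 Rplus RplusA RplusC Rplus0l.

Lemma rsum_ext d (f g : 'I_d -> R) :
  (forall i, f i = g i) -> rsum f = rsum g.
Proof. by move=> fg; apply: eq_bigr => i _; apply: fg. Qed.

Lemma rsum_add d (f g : 'I_d -> R) :
  rsum (fun i => f i + g i) = rsum f + rsum g.
Proof. exact: big_split. Qed.

Lemma rsum_scale d (a : R) (f : 'I_d -> R) :
  rsum (fun i => a * f i) = a * rsum f.
Proof.
rewrite /rsum; elim/big_rec2: _ => [|i x y _ ->]; ring.
Qed.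

Lemma rsum0 d : rsum (fun _ : 'I_d => 0) = 0.
Proof. by rewrite /rsum big1. Qed.

Lemma rsum_le d (f g : 'I_d -> R) :
  (forall i, f i <= g i) -> rsum f <= rsum g.
Proof.
move=> fg; rewrite /rsum; elim/big_rec2: _ => [|i x y _ xy]; first lra.
by have := fg i; lra.
Qed.

Lemma rsum_ge0 d (f : 'I_d -> R) : (forall i, 0 <= f i) -> 0 <= rsum f.
Proof. by move=> f0; rewrite -(rsum0 d); apply: rsum_le. Qed.

Lemma rsum_exchange d (f : 'I_d -> 'I_d -> R) :
  rsum (fun i => rsum (f i)) = rsum (fun j => rsum (fun i => f i j)).
Proof. exact: exchange_big. Qed.

Lemma rsum_single d (j : 'I_d) (f : 'I_d -> R) :
  (forall i, i <> j -> f i = 0) -> rsum f = f j.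
Proof.
move=> f0; rewrite /rsum (bigD1 j) //= big1 ?Rplus_0_r // => i /eqP ij.
exact: f0.
Qed.

Lemma rsum_term_le d (j : 'I_d) (f : 'I_d -> R) :
  (forall i, 0 <= f i) -> f j <= rsum f.
Proof.
move=> f0; pose g i := if i == j then f i else 0.
have gj : rsum g = g j by apply: rsum_single => i /eqP/negbTE; rewrite /g => ->.
have -> : f j = rsum g by rewrite gj /g eqxx.
by apply: rsum_le => i; rewrite /g; case: eqP => _; [lra | apply: f0].
Qed.

Lemma rsum_const d (x : R) : rsum (fun _ : 'I_d => x) = INR d * x.
Proof.
rewrite /rsum big_const_ord.
elim: d => [|d IH]; first by rewrite /=; ring.
by rewrite S_INR iterS IH; ring.
Qed.

Lemma rsum_const_prefix d n (x : R) : (n <= d)%N ->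
  rsum (fun i : 'I_d => if (i < n)%N then x else 0) = INR n * x.
Proof.
move=> nd; rewrite -(rsum_const n x) /rsum.
by rewrite (big_ord_widen d (fun=> x) nd) [RHS]big_mkcond.
Qed.

Lemma rsum_cv d (f : nat -> 'I_d -> R) (l : 'I_d -> R) :
  (forall i, Un_cv (fun n => f n i) (l i)) ->
  Un_cv (fun n => rsum (f n)) (rsum l).
Proof.
move=> fl; rewrite /rsum; elim: (index_enum _) => [|i s IH].
  by move=> e e0; exists 0%N => n _; rewrite !big_nil /Rdist Rminus_0_r Rabs_R0.
have := CV_plus _ _ _ _ (fl i) IH; rewrite big_cons => H e e0.
by have [N HN] := H e e0; exists N => n nN; rewrite big_cons; apply: HN.
Qed.

Section Involution.

Variables (d : nat) (pi : 'I_d -> 'I_d).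
Hypothesis piK : involutive pi.

Lemma rsum_involution (f : 'I_d -> R) : rsum (fun i => f (pi i)) = rsum f.
Proof. by rewrite /rsum [RHS](reindex_inj (inv_inj piK)). Qed.

(** Summation by parts over pairs: reindexing the [h (pi i)] half by [pi] and using oddness of [s]
    reproduces the other half. *)
Lemma rsum_odd_pairing (s h : 'I_d -> R) : (forall i, s (pi i) = - s i) ->
  rsum (fun i => s i * (h i - h (pi i))) = 2 * rsum (fun i => s i * h i).
Proof.
move=> sN.
rewrite (@rsum_ext _ _ (fun i => s i * h i + s (pi i) * h (pi i))); last first.
  by move=> i; rewrite sN; ring.
by rewrite rsum_add (rsum_involution (fun i => s i * h i)); ring.
Qed.

End Involution.

(** * Inner product, Euclidean norm and the unit ball *)

Section Vectors.

Variable d : nat.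
Implicit Types u v w : vec d.

Lemma dotC u v : dot u v = dot v u.
Proof. by apply: rsum_ext => i; ring. Qed.

Lemma dotDr u v w : dot u (vadd v w) = dot u v + dot u w.
Proof. by rewrite /dot -rsum_add; apply: rsum_ext => i; rewrite /vadd; ring. Qed.

Lemma dotZr a u v : dot u (vscale a v) = a * dot u v.
Proof. by rewrite /dot -rsum_scale; apply: rsum_ext => i; rewrite /vscale; ring. Qed.

Lemma dotBr u v w : dot u (vsub v w) = dot u v - dot u w.
Proof.
have -> : vsub v w = vadd v (vscale (-1) w).
  by apply: functional_extensionality => i; rewrite /vsub /vadd /vscale; ring.
by rewrite dotDr dotZr; ring.
Qed.

Lemma dotDl u v w : dot (vadd v w) u = dot v u + dot w u.
Proof. by rewrite dotC dotDr !(dotC u). Qed.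

Lemma dotZl a u v : dot (vscale a v) u = a * dot v u.
Proof. by rewrite dotC dotZr (dotC u). Qed.

Lemma dotBl u v w : dot (vsub v w) u = dot v u - dot w u.
Proof. by rewrite dotC dotBr !(dotC u). Qed.

Definition dotE := (dotBr, dotBl, dotDr, dotDl, dotZr, dotZl).

Lemma dot_ge0 u : 0 <= dot u u.
Proof. by apply: rsum_ge0 => i; nra. Qed.

Lemma dot_coord_le u i : u i ^ 2 <= dot u u.
Proof.
have := @rsum_term_le _ i (fun i => u i * u i) (fun i => Rle_0_sqr (u i)).
by rewrite /dot /=; lra.
Qed.

Lemma dot_eq0 u i : dot u u <= 0 -> u i = 0.
Proof. by move=> u0; have := dot_coord_le u i; nra. Qed.

Lemma norm_ge0 u : 0 <= norm u.
Proof. exact: sqrt_pos. Qed.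

Lemma norm_sq u : norm u ^ 2 = dot u u.
Proof. by rewrite /= Rmult_1_r; apply: sqrt_sqrt (dot_ge0 u). Qed.

Lemma norm_leP u x : 0 <= x -> norm u <= x <-> dot u u <= x ^ 2.
Proof.
move=> x0; have := norm_sq u; have := norm_ge0 u.
by split; nra.
Qed.

Lemma in_ballP u : in_ball u <-> dot u u <= 1.
Proof. by rewrite /in_ball norm_leP ?pow1 //; lra. Qed.

Lemma dot_cauchy_schwarz u v : dot u v <= norm u * norm v.
Proof.
have sq : dot u v ^ 2 <= dot u u * dot v v.
  have H t : 0 <= dot u u - 2 * t * dot u v + t ^ 2 * dot v v.
    have := dot_ge0 (vsub u (vscale t v)).
    by rewrite !dotE (dotC v u); lra.
  have [v0|v0] := Req_dec (dot v v) 0.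
    have [->|uv0] := Req_dec (dot u v) 0; first by rewrite v0; lra.
    (* With [dot v v = 0] the quadratic is affine in [t]; this [t] gives it the value -1. *)
    have := H ((dot u u + 1) / (2 * dot u v)); rewrite v0.
    have -> : 2 * ((dot u u + 1) / (2 * dot u v)) * dot u v = dot u u + 1 by field.
    lra.
  have vpos : 0 < dot v v by have := dot_ge0 v; lra.
  have := H (dot u v / dot v v).
  have -> : dot u u - 2 * (dot u v / dot v v) * dot u v +
    (dot u v / dot v v) ^ 2 * dot v v =
    (dot u u * dot v v - dot u v ^ 2) / dot v v by field.
  move=> H1; have := Rmult_le_compat_r _ _ _ (Rlt_le _ _ vpos) H1.
  by rewrite Rmult_0_l /Rdiv Rmult_assoc Rinv_l // Rmult_1_r; lra.
have := norm_ge0 u; have := norm_ge0 v => v0 u0.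
apply: Rsqr_incr_0_var; last by nra.
rewrite Rsqr_mult /Rsqr; have := norm_sq u; have := norm_sq v.
by rewrite /= !Rmult_1_r => -> ->; move: sq => /=; lra.
Qed.

Lemma norm_vscale a u : norm (vscale a u) = Rabs a * norm u.
Proof.
rewrite /norm !dotE -Rmult_assoc sqrt_mult; [|nra|exact: dot_ge0].
by rewrite -/(Rsqr a) sqrt_Rsqr_abs.
Qed.

Lemma in_ball_convex u v t : in_ball u -> in_ball v -> 0 <= t <= 1 ->
  in_ball (vadd (vscale t u) (vscale (1 - t) v)).
Proof.
rewrite !in_ballP => hu hv ht; have := dot_ge0 (vsub u v).
rewrite !dotE (dotC v u) => huv.
have : 0 <= t * (1 - t) * (dot u u - dot u v - (dot u v - dot v v)).
  by apply: Rmult_le_pos; nra.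
nra.
Qed.

End Vectors.

(* [G] is the gradient of a [mu]-strongly convex function with Lipschitz
   gradient; both properties are stated as global quadratic bounds. *)
Record quadratic_sandwich d (mu K : R) (F : vec d -> R) (G : vec d -> vec d) :
    Prop := QuadraticSandwich {
  sandwich_lower : forall u w,
    F w + dot (G w) (vsub u w) + mu / 2 * dot (vsub u w) (vsub u w) <= F u;
  sandwich_upper : forall u w,
    F u <= F w + dot (G w) (vsub u w) + K * dot (vsub u w) (vsub u w) }.

(** * Consequences of two-sided quadratic bounds *)

Section Sandwich.

Variables (d : nat) (mu K : R) (F : vec d -> R) (G : vec d -> vec d).
Hypotheses (mu_gt0 : 0 < mu) (FG : quadratic_sandwich mu K F G).

(** Average the lower bounds based at the intermediate point [z]: the linear terms cancel, and the
    quadratic ones add up to the factor [t * (1 - t)]. *)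
Lemma sandwich_strongly_convex lam :
  lam <= mu -> strongly_convex_on_ball lam F.
Proof.
move=> lam_mu u v t hu hv ht.
set z := vadd _ _.
have uz : vsub u z = vscale (1 - t) (vsub u v).
  by apply: functional_extensionality => i; rewrite /z /vsub /vadd /vscale; ring.
have vz : vsub v z = vscale (- t) (vsub u v).
  by apply: functional_extensionality => i; rewrite /z /vsub /vadd /vscale; ring.
have := sandwich_lower FG u z; have := sandwich_lower FG v z.
rewrite uz vz norm_sq !(dotZr, dotZl).
have := dot_ge0 (vsub u v); set D := dot (vsub u v) _; set g := dot _ _.
move=> D0 hv' hu'.
have hu2 := Rmult_le_compat_l t _ _ (proj1 ht) hu'.
have t1 : 0 <= 1 - t by lra.
have hv2 := Rmult_le_compat_l _ _ _ t1 hv'.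
have : 0 <= (mu - lam) * (t * (1 - t) * D).
  by apply: Rmult_le_pos; [lra | apply: Rmult_le_pos => //; nra].
nra.
Qed.

Lemma sandwich_lipschitz L :
  (forall w, in_ball w -> norm (G w) <= L) -> lipschitz_on_ball L F.
Proof.
move=> GL.
have half u v : in_ball u -> F u - F v <= L * norm (vsub u v).
  move=> hu; have := sandwich_lower FG v u.
  have -> : vsub v u = vscale (-1) (vsub u v).
    by apply: functional_extensionality => i; rewrite /vsub /vscale; ring.
  rewrite !(dotZr, dotZl); have := dot_ge0 (vsub u v).
  have := dot_cauchy_schwarz (G u) (vsub u v); have := norm_ge0 (vsub u v).
  have := GL u hu => h1 h2 h3 h4 h5.
  have := Rmult_le_compat_r _ _ _ h2 h1; nra.
move=> u v hu hv; apply: Rabs_le; split; last exact: half.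
have := half v u hv.
have -> : vsub v u = vscale (-1) (vsub u v).
  by apply: functional_extensionality => i; rewrite /vsub /vscale; ring.
by rewrite norm_vscale Rabs_Ropp Rabs_R1; lra.
Qed.

(** Replaces a limit [t -> 0] in first-order arguments where the second-order error carries an extra
    factor [t]. *)
Lemma le0_of_le_small (x C : R) :
  (forall t, 0 < t <= 1 -> x <= t * C) -> x <= 0.
Proof.
move=> H; apply: Rnot_lt_le => x0.
have C0 : 0 < C by have := H 1; lra.
have q : 0 < x / (2 * C) by apply: Rdiv_lt_0_compat; lra.
have xC : x <= C by have := H 1; lra.
have e : x / (2 * C) * C = x / 2 by field; lra.
have := H (x / (2 * C)); rewrite e.
have : x / (2 * C) <= 1 by apply: (Rmult_le_reg_r C) => //; lra.
lra.
Qed.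

(* The summand [s * w] comes from the normal cone of the ball, which is
   nontrivial at boundary points. *)
Lemma sandwich_subgrad w g : subgrad F w g ->
  exists s, 0 <= s /\ forall i, g i = G w i + s * w i.
Proof.
move=> [hw hg]; have [v vE] : exists v, v = vsub g (G w) by exists (vsub g (G w)).
(* The vector [v] lies in the normal cone at [w]: compare the subgradient inequality with the upper
   bound on the segment from [w] to [u] and divide by [t]. *)
have vcone u : in_ball u -> dot v (vsub u w) <= 0.
  move=> hu; apply: (@le0_of_le_small _ (K * dot (vsub u w) (vsub u w))) => t ht.
  have zb : in_ball (vadd (vscale t u) (vscale (1 - t) w)).
    by apply: in_ball_convex => //; lra.
  have := hg _ zb; have := sandwich_upper FG (vadd (vscale t u) (vscale (1 - t) w)) w.
  have -> : vsub (vadd (vscale t u) (vscale (1 - t) w)) w = vscale t (vsub u w).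
    by apply: functional_extensionality => i; rewrite /vsub /vadd /vscale; ring.
  rewrite vE dotBl !(dotZr, dotZl) => h1 h2.
  by apply: (Rmult_le_reg_l t); [lra | nra].
exists (norm v); split; first exact: norm_ge0.
suff v_eq i : v i = norm v * w i.
  by move=> i; rewrite -v_eq vE /vsub; ring.
suff : vsub v (vscale (norm v) w) i = 0 by rewrite /vsub /vscale; lra.
apply: dot_eq0; rewrite !dotE (dotC w v).
have [v0|v0] := Req_dec (norm v) 0.
  by have := norm_sq v; rewrite v0; lra.
have vpos : 0 < norm v by have := norm_ge0 v; lra.
(* Testing the cone at [v / norm v] gives [norm v <= dot v w]; together with [norm w <= 1] this
   forces [v = norm v * w]. *)
have bv : in_ball (vscale (/ norm v) v).
  rewrite /in_ball norm_vscale Rabs_inv (Rabs_pos_eq (norm v)); last lra.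
  by rewrite Rinv_l //; lra.
have := vcone _ bv; rewrite !dotE -norm_sq.
have -> : / norm v * norm v ^ 2 = norm v by field.
move=> h; move/in_ballP: hw => hw.
have := Rmult_le_compat_l _ _ _ (Rlt_le _ _ vpos) h.
have := Rmult_le_compat_l _ _ _ (Rle_0_sqr (norm v)) hw; rewrite /Rsqr.
nra.
Qed.

(** If [v = g - G w] were nonzero, a short step along [v] would raise [F] to first order faster than
    the upper bound allows. *)
Lemma sandwich_gradient_unique w g :
  has_gradient F w g -> forall i, g i = G w i.
Proof.
move=> hg; have [v vE] : exists v, v = vsub g (G w) by exists (vsub g (G w)).
move=> i; suff v0 : v i = 0 by move: v0; rewrite vE /vsub; lra.
apply: dot_eq0; apply: Rnot_lt_le => vpos {i}.
have npos : 0 < norm v by apply: sqrt_lt_R0.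
have [del [del0 hdel]] := hg (norm v / 2) ltac:(lra).
(* A step [s * v] with [s <= t0] stays within the radius [del] where the error is at most half of
   the first-order gain. *)
pose t0 := Rmin 1 (del / (2 * norm v)).
have q0 : 0 < del / (2 * norm v) by apply: Rdiv_lt_0_compat; lra.
have t00 : 0 < t0 by apply: Rmin_glb_lt; lra.
suff : dot v v / 2 <= 0 by lra.
apply: (@le0_of_le_small _ (t0 * (K * dot v v))) => t ht.
pose s := t * t0.
have s0 : 0 < s by apply: Rmult_lt_0_compat; lra.
pose u := vadd w (vscale s v).
have uw : vsub u w = vscale s v.
  by apply: functional_extensionality => i; rewrite /u /vsub /vadd /vscale; ring.
have nu : norm (vsub u w) = s * norm v by rewrite uw norm_vscale Rabs_pos_eq; lra.
have small : norm (vsub u w) < del.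
  have := Rmin_r 1 (del / (2 * norm v)); rewrite -/t0 => t0le.
  have := Rmult_le_compat_r _ _ _ (Rlt_le _ _ npos) t0le.
  have -> : del / (2 * norm v) * norm v = del / 2 by field; lra.
  have : s * norm v <= t0 * norm v.
    by apply: Rmult_le_compat_r; [lra | rewrite /s; nra].
  rewrite nu; lra.
have := hdel u small; have := sandwich_upper FG u w; rewrite nu uw.
move=> hup; rewrite Rabs_minus_sym => /(Rle_trans _ _ _ (Rle_abs _)) hlow.
have nn := norm_sq v.
have vv : dot g v - dot (G w) v = dot v v by rewrite -dotBl vE.
move: hup hlow; rewrite !(dotZr, dotZl) => hup hlow.
have e1 : norm v / 2 * (s * norm v) = s * (dot v v / 2) by rewrite -nn; field.
have fin : s * (dot v v / 2) <= s * (s * (K * dot v v)).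
  rewrite e1 in hlow; nra.
have := Rmult_le_reg_l _ _ _ s0 fin; rewrite /s; lra.
Qed.

End Sandwich.

(** * Existence of a minimizer over the ball *)

Lemma norm_triangle d (u v : vec d) : norm (vadd u v) <= norm u + norm v.
Proof.
have u0 := norm_ge0 u; have v0 := norm_ge0 v.
apply/norm_leP; first lra.
rewrite !dotE (dotC v u) -!norm_sq.
by have := dot_cauchy_schwarz u v; nra.
Qed.

Lemma cv_const (x : R) : Un_cv (fun=> x) x.
Proof. by move=> e e0; exists 0%N => n _; rewrite /Rdist Rminus_diag Rabs_R0. Qed.

(* Strong convexity makes every minimizing sequence Cauchy, so no compactness
   argument is needed. *)
Lemma strongly_convex_min_exists d mu L (F : vec d -> R) :
  0 < mu -> strongly_convex_on_ball mu F -> lipschitz_on_ball L F ->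
  exists w, in_ball w /\ forall u, in_ball u -> F w <= F u.
Proof.
move=> mu0 Fsc FL.
have zb : in_ball (@vzero d).
  apply/in_ballP; rewrite /dot (@rsum_ext _ _ (fun=> 0)) ?rsum0; first lra.
  by move=> i; rewrite /vzero; ring.
pose A x := exists u, in_ball u /\ x = - F u.
have [s [sub slub]] : {s | is_lub A s}.
  apply: completeness; last by exists (- F (@vzero d)), (@vzero d).
  exists (- F (@vzero d) + Rabs L) => x [u [ub ->]].
  have := FL _ _ zb ub; have -> : norm (vsub (@vzero d) u) = norm u.
    have -> : vsub (@vzero d) u = vscale (-1) u.
      by apply: functional_extensionality => i; rewrite /vsub /vzero /vscale; ring.
    by rewrite norm_vscale Rabs_Ropp Rabs_R1 Rmult_1_l.
  move/(Rle_trans _ _ _ (Rle_abs _)) => h.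
  have := norm_ge0 u; have := ub; rewrite /in_ball; have := Rle_abs L.
  by have := Rabs_pos L; nra.
have inf_le u : in_ball u -> - s <= F u.
  by move=> ub; have := sub (- F u) (ex_intro _ u (conj ub erefl)); lra.
have inf_near e : 0 < e -> exists u, in_ball u /\ F u <= - s + e.
  move=> e0; apply: NNPP => H.
  have : s <= s - e; last lra.
  apply: slub => x [u [ub ->]].
  have [//|h] := Rle_lt_dec (- F u) (s - e).
  by case: H; exists u; split=> //; lra.
pose r (n : nat) := / INR n.+1.
have r0 n : 0 < r n by apply: Rinv_0_lt_compat; apply: lt_0_INR; lia.
have r_small e : 0 < e -> exists N, forall n, (n >= N)%coq_nat -> r n < e.
  move=> e0; have [N [NR N0]] := archimed_cor1 e e0; exists N => n nN.
  apply: Rle_lt_trans NR; apply: Rinv_le_contravar; first exact: lt_0_INR.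
  by apply: le_INR; lia.
have /choice [x xP] : forall n, exists u, in_ball u /\ F u <= - s + r n.
  by move=> n; apply: inf_near.
(* The midpoint value is at least the infimum [- s], and by strong convexity at most the mean of the
   two values minus [mu / 8] times the squared distance. *)
have x_cauchy n m : dot (vsub (x n) (x m)) (vsub (x n) (x m)) <= 4 / mu * (r n + r m).
  have [xn Fn] := xP n; have [xm Fm] := xP m.
  have h12 : 0 <= 1 / 2 <= 1 by lra.
  have := Fsc _ _ _ xn xm h12; have := inf_le _ (in_ball_convex xn xm h12).
  rewrite norm_sq => h1 h2.
  apply: (Rmult_le_reg_l (mu / 8)); first lra.
  have -> : mu / 8 * (4 / mu * (r n + r m)) = (r n + r m) / 2 by field; lra.
  lra.
have /choice [w wP] : forall i : 'I_d, exists l, Un_cv (fun n => x n i) l.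
  move=> i; have [|l lP] := R_complete (fun n => x n i); last by exists l.
  move=> e e0.
  have me : 0 < mu * e ^ 2 / 8.
    by apply: Rdiv_lt_0_compat; [apply: Rmult_lt_0_compat => //; apply: pow_lt | lra].
  have [N HN] := r_small _ me.
  exists N => n m nN mN; rewrite /Rdist.
  have := Rle_trans _ _ _ (dot_coord_le (vsub (x n) (x m)) i) (x_cauchy n m).
  rewrite {1}/vsub => h.
  have : 4 / mu * (r n + r m) < 4 / mu * (mu * e ^ 2 / 4).
    apply: Rmult_lt_compat_l; first by apply: Rdiv_lt_0_compat; lra.
    by have := HN n nN; have := HN m mN; lra.
  have -> : 4 / mu * (mu * e ^ 2 / 4) = e ^ 2 by field; lra.
  by move=> h'; apply: Rabs_def1; nra.
have wb : in_ball w.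
  apply/in_ballP.
  have cv : Un_cv (fun n => dot (x n) (x n)) (dot w w).
    by apply: rsum_cv => i; apply: CV_mult.
  apply: (Rle_cv_lim _ cv (cv_const 1)) => n.
  by apply/in_ballP; case: (xP n).
exists w; split=> // u ub; apply: Rle_trans (inf_le u ub).
(* An excess [e] of [F w] over the infimum is contradicted by a late [x n]: its own excess is below
   [e / 2], and the Lipschitz bound adds at most [e / 2]. *)
apply: Rnot_lt_le => lt; pose e := F w + s.
have [N HN] := r_small (e / 2) ltac:(rewrite /e; lra).
have cv : Un_cv (fun n => dot (vsub (x n) w) (vsub (x n) w)) (dot (vsub w w) (vsub w w)).
  by apply: rsum_cv => i; apply: CV_mult; apply: CV_minus => //; apply: cv_const.
have ww0 : dot (vsub w w) (vsub w w) = 0 by rewrite !dotE; ring.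
have L0 := Rabs_pos L.
pose eta := e / (2 * (Rabs L + 1)).
have eta0 : 0 < eta by apply: Rdiv_lt_0_compat; rewrite /e; lra.
have [N' HN'] := cv (eta ^ 2) ltac:(nra).
pose n := Nat.max N N'.
have := HN' n ltac:(rewrite /n; lia).
have := HN n ltac:(rewrite /n; lia).
rewrite /Rdist ww0 Rminus_0_r => rn /(Rle_lt_trans _ _ _ (Rle_abs _)) dn.
have nn : norm (vsub (x n) w) <= eta by apply/norm_leP; lra.
have [xb Fx] := xP n.
have := FL _ _ xb wb; rewrite Rabs_minus_sym => /(Rle_trans _ _ _ (Rle_abs _)) h.
have : L * norm (vsub (x n) w) <= (Rabs L + 1) * eta.
  have := norm_ge0 (vsub (x n) w); have := Rle_abs L; nra.
have -> : (Rabs L + 1) * eta = e / 2 by rewrite /eta; field; lra.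
by rewrite /e in rn *; lra.
Qed.

(** * The smoothed absolute value *)

Definition smooth_abs del x := sqrt (x ^ 2 + del ^ 2).

(** The derivative of [smooth_abs del]. *)
Definition smooth_sign del x := x / smooth_abs del x.

Section SmoothAbs.

Variable del : R.
Hypothesis del_gt0 : 0 < del.

Lemma smooth_abs_gt0 x : 0 < smooth_abs del x.
Proof. by apply: sqrt_lt_R0; nra. Qed.

Lemma smooth_abs_sq x : smooth_abs del x ^ 2 = x ^ 2 + del ^ 2.
Proof. by rewrite /= Rmult_1_r; apply: sqrt_sqrt; nra. Qed.

Lemma smooth_abs0 : smooth_abs del 0 = del.
Proof.
have := smooth_abs_sq 0; have := smooth_abs_gt0 0; nra.
Qed.

Lemma smooth_sign0 : smooth_sign del 0 = 0.
Proof. by rewrite /smooth_sign /Rdiv Rmult_0_l. Qed.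

Lemma smooth_signN x : smooth_sign del (- x) = - smooth_sign del x.
Proof.
rewrite /smooth_sign /smooth_abs.
have -> : (- x) ^ 2 = x ^ 2 by ring.
by rewrite /Rdiv; ring.
Qed.

Lemma smooth_sign_sq_le1 x : smooth_sign del x ^ 2 <= 1.
Proof.
have p0 := smooth_abs_gt0 x; rewrite /smooth_sign.
have -> : (x / smooth_abs del x) ^ 2 = 1 - del ^ 2 / smooth_abs del x ^ 2.
  have -> : del ^ 2 = smooth_abs del x ^ 2 - x ^ 2 by rewrite smooth_abs_sq; ring.
  by field; lra.
have : 0 < del ^ 2 / smooth_abs del x ^ 2 by apply: Rdiv_lt_0_compat; nra.
lra.
Qed.

Lemma smooth_abs_ge_mul t x : t ^ 2 <= 1 -> t * x <= smooth_abs del x.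
Proof.
move=> t1; have := smooth_abs_sq x; have := smooth_abs_gt0 x => p0 pE.
apply: Rnot_lt_le => h; have : smooth_abs del x ^ 2 < (t * x) ^ 2 by nra.
have : 0 <= (1 - t ^ 2) * x ^ 2 by apply: Rmult_le_pos; nra.
nra.
Qed.

(** Lagrange's identity for the plane vectors [(x, del)] and [(y, del)]. It yields both quadratic
    bounds without second derivatives. *)
Lemma smooth_abs_prod x y :
  (smooth_abs del x * smooth_abs del y) ^ 2 = (x * y + del ^ 2) ^ 2 + (del * (x - y)) ^ 2.
Proof. by rewrite Rpow_mult_distr !smooth_abs_sq; ring. Qed.

(** Multiplied by [smooth_abs del x], the claim is Cauchy-Schwarz for [(x, del)] and [(y, del)]. *)
Lemma smooth_abs_lower x y :
  smooth_abs del x + smooth_sign del x * (y - x) <= smooth_abs del y.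
Proof.
have p0 := smooth_abs_gt0 x; have q0 := smooth_abs_gt0 y.
have pE := smooth_abs_sq x; have pq := smooth_abs_prod x y.
rewrite /smooth_sign; apply: (Rmult_le_reg_l (smooth_abs del x)) => //.
have -> : smooth_abs del x * (smooth_abs del x + x / smooth_abs del x * (y - x)) =
    smooth_abs del x ^ 2 + x * (y - x) by field; lra.
have := Rmult_lt_0_compat _ _ p0 q0; move: (_ * smooth_abs del y) pq => z pq z0.
rewrite pE; apply: Rnot_lt_le => h; have := pow2_ge_0 (del * (x - y)); nra.
Qed.

Lemma smooth_abs_upper x y :
  smooth_abs del y <=
    smooth_abs del x + smooth_sign del x * (y - x) + (y - x) ^ 2 / del.
Proof.
have p0 := smooth_abs_gt0 x; have q0 := smooth_abs_gt0 y.
have pE := smooth_abs_sq x; have pq := smooth_abs_prod x y.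
have low := smooth_abs_lower x y.
have pdel : del <= smooth_abs del x by nra.
rewrite /smooth_sign; apply: (Rmult_le_reg_l (smooth_abs del x)) => //.
have -> : smooth_abs del x * (smooth_abs del x + x / smooth_abs del x * (y - x) +
    (y - x) ^ 2 / del) = smooth_abs del x ^ 2 + x * (y - x) +
    smooth_abs del x * ((y - x) ^ 2 / del) by field; lra.
have : (y - x) ^ 2 <= smooth_abs del x * ((y - x) ^ 2 / del).
  have {1}-> : (y - x) ^ 2 = del * ((y - x) ^ 2 / del) by field; lra.
  apply: Rmult_le_compat_r => //.
  by apply: Rmult_le_pos; [apply: pow2_ge_0 | apply/Rlt_le/Rinv_0_lt_compat].
suff : smooth_abs del x * smooth_abs del y <= x * y + del ^ 2 + (y - x) ^ 2.
  by rewrite pE; lra.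
have := Rmult_lt_0_compat _ _ p0 q0; move: (_ * smooth_abs del y) pq => z pq z0.
(* With [A = x * y + del ^ 2], the identity reads [(z + A) * (z - A) = del ^ 2 * (y - x) ^ 2]; since
   the first factor is at least [del ^ 2], the second is at most [(y - x) ^ 2]. *)
have h1 : del ^ 2 <= z + (x * y + del ^ 2).
  suff : - (x * y) <= z by lra.
  apply: Rnot_lt_le => h; have : z ^ 2 < (x * y) ^ 2 by nra.
  have := pow2_ge_0 (del * x); have := pow2_ge_0 (del * y); have := pow2_ge_0 (del ^ 2).
  by rewrite pq; lra.
apply: Rnot_lt_le => h2.
have h3 : (z + (x * y + del ^ 2)) * (z - (x * y + del ^ 2)) = del ^ 2 * (y - x) ^ 2.
  by have -> : del ^ 2 * (y - x) ^ 2 = z ^ 2 - (x * y + del ^ 2) ^ 2; [rewrite pq|]; ring.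
have dd : 0 < del ^ 2 by nra.
have := pow2_ge_0 (y - x); nra.
Qed.

End SmoothAbs.

(** * Functions coupling coordinates in disjoint pairs *)

Section Paired.

Variables (d : nat) (pi : 'I_d -> 'I_d) (a : vec d) (c mu del : R).
Hypotheses (piK : involutive pi) (c_ge0 : 0 <= c) (del_gt0 : 0 < del).

(* Each pair [{i, pi i}] is counted twice in the sum, hence the [c / 2]. *)
Definition paired (w : vec d) : R :=
  dot a w + c / 2 * rsum (fun i => smooth_abs del (w i - w (pi i))) +
  mu / 2 * dot w w.

(** The factor is [c] because coordinate [i] enters the two equal terms indexed by [i] and
    [pi i]. *)
Definition paired_grad (w : vec d) : vec d :=
  fun i => a i + c * smooth_sign del (w i - w (pi i)) + mu * w i.

(** The first-order remainder splits into scalar remainders of [smooth_abs], one for each index, and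
    the quadratic term; summation by parts brings the gradient into pair form. *)
Lemma paired_taylor u w :
  paired u - paired w - dot (paired_grad w) (vsub u w) =
    c / 2 * rsum (fun i => smooth_abs del (u i - u (pi i)) -
      smooth_abs del (w i - w (pi i)) -
      smooth_sign del (w i - w (pi i)) * (vsub u w i - vsub u w (pi i))) +
    mu / 2 * dot (vsub u w) (vsub u w).
Proof.
pose s i := smooth_sign del (w i - w (pi i)).
have sN i : s (pi i) = - s i.
  by rewrite /s piK -(smooth_signN del); congr smooth_sign; ring.
have GE : paired_grad w = vadd (vadd a (vscale c s)) (vscale mu w) by [].
have sh : dot s (vsub u w) = / 2 * rsum (fun i => s i * (vsub u w i - vsub u w (pi i))).
  by rewrite (rsum_odd_pairing piK _ sN) /dot; field.
rewrite GE (dotDl _ (vadd a _)) (dotDl _ a) (dotZl c _ s) sh.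
rewrite (@rsum_ext _ (fun i => _ - _ - _) (fun i => smooth_abs del (u i - u (pi i)) +
    (-1 * smooth_abs del (w i - w (pi i)) +
     -1 * (s i * (vsub u w i - vsub u w (pi i)))))); last by move=> i; rewrite /s; ring.
rewrite !rsum_add !rsum_scale /paired !dotE (dotC w u); field.
Qed.

Lemma paired_sandwich :
  quadratic_sandwich mu (2 * c / del + mu / 2) paired paired_grad.
Proof.
have c2 : 0 <= c / 2 by lra.
split=> u w; have := paired_taylor u w; set R := rsum _.
- have R0 : 0 <= R.
    apply: rsum_ge0 => i.
    have := smooth_abs_lower del_gt0 (w i - w (pi i)) (u i - u (pi i)).
    have -> : u i - u (pi i) - (w i - w (pi i)) = vsub u w i - vsub u w (pi i).
      by rewrite /vsub; ring.
    lra.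
  by have := Rmult_le_pos _ _ c2 R0; lra.
- have R0 : R <= 4 / del * dot (vsub u w) (vsub u w).
    pose h := vsub u w; rewrite -/h.
    have -> : 4 / del * dot h h = rsum (fun i => 2 / del * (h i * h i) +
        2 / del * (h (pi i) * h (pi i))).
      rewrite rsum_add !rsum_scale (rsum_involution piK (fun i => h i * h i)).
      by rewrite /dot; field; lra.
    apply: rsum_le => i.
    have := smooth_abs_upper del_gt0 (w i - w (pi i)) (u i - u (pi i)).
    have -> : u i - u (pi i) - (w i - w (pi i)) = h i - h (pi i).
      by rewrite /h /vsub; ring.
    have -> : 2 / del * (h i * h i) + 2 / del * (h (pi i) * h (pi i)) =
        (h i - h (pi i)) ^ 2 / del + (h i + h (pi i)) ^ 2 / del by field; lra.
    have : 0 <= (h i + h (pi i)) ^ 2 / del.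
      by apply: Rmult_le_pos; [apply: pow2_ge_0 | apply/Rlt_le/Rinv_0_lt_compat].
    rewrite -/h; lra.
  have := Rmult_le_compat_l _ _ _ c2 R0.
  have -> : c / 2 * (4 / del * dot (vsub u w) (vsub u w)) =
    2 * c / del * dot (vsub u w) (vsub u w) by field; lra.
  lra.
Qed.

(** Entry [i] of the gradient depends only on [w i] and [w (pi i)], so a step along the basis vector
    [ej] leaves it unchanged. Uniqueness of gradients identifies [G] with [paired_grad]. *)
Lemma paired_hessian_sparse w H i j :
  has_hessian paired w H -> j <> i -> j <> pi i -> H i j = 0.
Proof.
move=> [G [r [r0 [_ [hG hH]]]]] ji jpi.
suff le e : 0 < e -> Rabs (H i j) <= e.
  apply: NNPP => /Rabs_pos_lt h; have := le (Rabs (H i j) / 2) ltac:(lra); lra.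
move=> e0; have [del' [del'0 hdel]] := hH e e0.
pose t := Rmin del' r / 2.
have t0 : 0 < t by have := Rmin_glb_lt _ _ _ del'0 r0; rewrite /t; lra.
have tdel : t < del' by have := Rmin_l del' r; rewrite /t in t0 *; lra.
have tr : t < r by have := Rmin_r del' r; rewrite /t in t0 *; lra.
pose ej : vec d := fun k => if k == j then 1 else 0.
have ejE k : k <> j -> ej k = 0 by move/eqP/negbTE; rewrite /ej => ->.
have ejj : ej j = 1 by rewrite /ej eqxx.
pose u := vadd w (vscale t ej).
have uw : vsub u w = vscale t ej.
  by apply: functional_extensionality => k; rewrite /u /vsub /vadd /vscale; ring.
have nu : norm (vsub u w) = t.
  rewrite uw norm_vscale Rabs_pos_eq; last lra.
  rewrite /norm (_ : dot ej ej = 1) ?sqrt_1 ?Rmult_1_r //.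
  rewrite /dot (@rsum_single _ j) ?ejj; first ring.
  by move=> k kj; rewrite ejE //; ring.
have nw : norm (vsub w w) < r.
  have -> : vsub w w = vscale 0 w.
    by apply: functional_extensionality => k; rewrite /vsub /vscale; ring.
  by rewrite norm_vscale Rabs_R0 Rmult_0_l.
have Gu : G u i = paired_grad u i.
  by apply: (sandwich_gradient_unique paired_sandwich); apply: hG; rewrite nu.
have Gw : G w i = paired_grad w i.
  by apply: (sandwich_gradient_unique paired_sandwich); apply: hG.
have GuGw : paired_grad u i = paired_grad w i.
  by rewrite /paired_grad /u /vadd /vscale !ejE ?Rmult_0_r ?Rplus_0_r //; apply: nesym.
have Hu : mulmv H (vsub u w) i = t * H i j.
  rewrite /mulmv (@rsum_single _ j) uw /vscale ?ejj; first ring.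
  by move=> k kj; rewrite ejE //; ring.
have := hdel u ltac:(lra); rewrite nu => h.
have et : 0 <= e * t by nra.
have := Rle_trans _ _ _ (dot_coord_le _ i) (proj1 (norm_leP _ et) h).
rewrite {1}/vsub Hu {1}/vsub Gu Gw GuGw => hh.
have tt : 0 < t ^ 2 by nra.
have : H i j ^ 2 <= e ^ 2 by apply: (Rmult_le_reg_l (t ^ 2)) => //; lra.
by move=> h2; apply: Rabs_le; nra.
Qed.

End Paired.

(** * Supports under local computation *)

Lemma mulmv_inverse d (M N : mat d) v i :
  mmul M N = @idm d -> mulmv M (mulmv N v) i = v i.
Proof.
move=> MN; rewrite /mulmv.
transitivity (rsum (fun k => mmul M N i k * v k)).
  rewrite (@rsum_ext _ _ (fun j => rsum (fun k => M i j * N j k * v k))); last first.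
    by move=> j; rewrite -rsum_scale; apply: rsum_ext => k; ring.
  rewrite rsum_exchange; apply: rsum_ext => k.
  rewrite [RHS]Rmult_comm /mmul -rsum_scale; apply: rsum_ext => j; ring.
rewrite MN (@rsum_single _ i) /idm ?eqxx; first exact: Rmult_1_l.
by move=> k /eqP; rewrite eq_sym => /negbTE ->; apply: Rmult_0_l.
Qed.

Definition below d T (w : vec d) : Prop := forall i : 'I_d, (T <= i)%N -> w i = 0.

Lemma below_le d T T' (w : vec d) : (T <= T')%N -> below T w -> below T' w.
Proof. by move=> TT wT i iT; apply: wT; apply: leq_trans iT. Qed.

Lemma span_below d T (X : vec d -> Prop) v :
  (forall x, X x -> below T x) -> span_of X v -> below T v.
Proof.
move=> XT [l [lX ->]] i iT; elim: l lX => [//|p l IH] lX.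
rewrite /= /vadd /vscale XT //; last by apply: lX; left.
by rewrite IH => [|q ql]; [ring | apply: lX; right].
Qed.

Section Locality.

Variables (d : nat) (pi : 'I_d -> 'I_d) (a : vec d) (c mu del : R) (T : nat).
Hypotheses (piK : involutive pi) (c_ge0 : 0 <= c) (mu_gt0 : 0 < mu).
Hypotheses (del_gt0 : 0 < del) (a_below : below T a).
(** No pair straddles the cut between coordinates [T - 1] and [T]. *)
Hypothesis piT : forall i, (T <= pi i)%N = (T <= i)%N.

Notation F := (paired pi a c mu del).
Notation G := (paired_grad pi a c mu del).

Let FG : quadratic_sandwich mu (2 * c / del + mu / 2) F G.
Proof. exact: paired_sandwich. Qed.

Lemma paired_grad_below w : below T w -> below T (G w).
Proof.
move=> wT i iT; rewrite /paired_grad a_below // !wT ?piT //.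
by rewrite Rminus_0_r (smooth_sign0 del); ring.
Qed.

Lemma subgrad_below w g : below T w -> subgrad F w g -> below T g.
Proof.
move=> wT /(sandwich_subgrad FG) [s [_ gE]] i iT.
by rewrite gE paired_grad_below // wT //; ring.
Qed.

Lemma shifted_hessian_block w H D (i j : 'I_d) :
  has_hessian F w H -> diagonal D -> (T <= i)%N != (T <= j)%N ->
  madd H D i j = 0.
Proof.
move=> hH hD ij.
have ji : j <> i by move=> ji; rewrite ji eqxx in ij.
have jpi : j <> pi i by move=> jpi; rewrite jpi piT eqxx in ij.
rewrite /madd (paired_hessian_sparse piK c_ge0 del_gt0 hH ji jpi).
by rewrite hD ?Rplus_0_r //; apply: nesym.
Qed.

Lemma gen_below W v : (forall w, In w W -> below T w) -> gen F W v -> below T v.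
Proof.
move=> WT [/WT//|[[w [/WT wT]]|[]]]; first exact: subgrad_below.
- move=> [w [w' [H [D [N [_ [/WT w'T [hH [hD [_ ->]]]]]]]]]] i iT.
  rewrite /mulmv (@rsum_ext _ _ (fun=> 0)) ?rsum0 // => j.
  have [jT|jT] := leqP T j; first by rewrite w'T // Rmult_0_r.
  by rewrite (shifted_hessian_block hH hD) ?Rmult_0_l // iT leqNgt jT.
- move=> [w [w' [H [D [N [_ [/WT w'T [hH [hD [[AN NA] ->]]]]]]]]]].
  set A := madd H D in AN NA; set x := mulmv N w'.
  have block (i j : 'I_d) : (T <= i)%N != (T <= j)%N -> A i j = 0.
    exact: shifted_hessian_block hH hD.
  (* [A] commutes with the projection onto the coordinates [>= T], so the
     projection [y] of [x] satisfies [A y = 0]. *)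
  pose y : vec d := fun i => if (T <= i)%N then x i else 0.
  have Ay i : mulmv A y i = 0.
    have [iT|iT] := boolP (T <= i)%N.
      rewrite -(w'T i iT) -(mulmv_inverse w' i AN); apply: rsum_ext => j.
      rewrite /y; case: ifP => // jT.
      by rewrite block ?iT ?jT //; ring.
    rewrite /mulmv (@rsum_ext _ _ (fun=> 0)) ?rsum0 // => j.
    rewrite /y; case: ifP => jT; last by rewrite Rmult_0_r.
    by rewrite block ?(negbTE iT) ?jT //; ring.
  move=> i iT; have -> : x i = y i by rewrite /y iT.
  rewrite -(mulmv_inverse y i NA) /mulmv (@rsum_ext _ _ (fun=> 0)) ?rsum0 // => j.
  by rewrite -/(mulmv A y j) Ay Rmult_0_r.
Qed.

(** Beyond the cut, the equations at [i] and [pi i] hold with right-hand side 0. Their sum cancels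
    the odd sign terms and gives [w (pi i) = - w i]; the sign term then pulls in the direction of
    [w i], which must vanish. *)
Lemma can_add_below W w :
  (forall x, In x W -> below T x) -> can_add F W w -> below T w.
Proof.
move=> WT [g [gam [nu [hg [gam0 [nu0 [gn0 hs]]]]]]].
have [s [s0 gE]] := sandwich_subgrad FG hg.
have z := span_below (fun v => gen_below WT (v := v)) hs.
move=> i iT; have piiT : (T <= pi i)%N by rewrite piT.
have := z i iT; have := z (pi i) piiT.
rewrite /vadd /vscale !gE /paired_grad !a_below // piK.
have -> : w (pi i) - w i = - (w i - w (pi i)) by ring.
rewrite (smooth_signN del); set x := w i - w (pi i) => h1 h2.
(* The total coefficient of [w i] outside the sign term. The regularizer makes it positive even if
   [gam = 0]. *)
pose B := gam + nu * s + nu * mu.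
have B0 : 0 < B.
  have := Rmult_le_pos _ _ nu0 s0; rewrite /B.
  have [nuE|nu1] : nu = 0 \/ 0 < nu by lra.
    by rewrite nuE in gn0 *; lra.
  by have := Rmult_lt_0_compat _ _ nu1 mu_gt0; lra.
have sum0 : B * (w i + w (pi i)) = 0 by rewrite /B; lra.
have wpi : w (pi i) = - w i by nra.
have p0 := smooth_abs_gt0 del_gt0 x.
have q0 : 0 <= nu * c * (2 / smooth_abs del x).
  apply: Rmult_le_pos; first exact: Rmult_le_pos.
  by apply/Rlt_le/Rdiv_lt_0_compat; lra.
have sx : smooth_sign del x = 2 / smooth_abs del x * w i.
  by rewrite /smooth_sign {1}/x wpi; field; lra.
have : (B + nu * c * (2 / smooth_abs del x)) * w i = 0.
  by rewrite sx in h2; rewrite /B; lra.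
nra.
Qed.

Lemma local_reach_below W W' :
  (forall w, In w W -> below T w) -> local_reach F W W' ->
  forall w, In w W' -> below T w.
Proof.
move=> WT H; elim: H WT => {W W'} [//|W W' w _ IH hw] WT x /= [<-|]; last exact: IH.
by apply: can_add_below hw; apply: IH.
Qed.

End Locality.

(** * The chain and its two matchings *)

Definition chain_partner n (p : bool) (i : nat) : nat :=
  if odd i == p then (if (i.+1 < n)%N then i.+1 else i)
  else (if (0 < i < n)%N then i.-1 else i).

Lemma chain_partner_lt n p d i :
  (n <= d)%N -> (i < d)%N -> (chain_partner n p i < d)%N.
Proof.
rewrite /chain_partner => nd id; case: ifP => _; case: ifP => // h.
- exact: leq_trans h nd.
- exact: leq_ltn_trans (leq_pred i) id.
Qed.

Lemma chain_partnerK n p : involutive (chain_partner n p).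
Proof.
move=> i; rewrite /chain_partner; case: (odd i =P p) => ip;
  [case h: (i.+1 < n)%N | case h: (0 < i < n)%N].
- by rewrite /= -ip; case: (odd i); rewrite /= h.
- by rewrite ip eqxx h.
- case: i ip h => //= i ip /= h.
  by have -> : odd i == p; [case: (odd i) p ip {h} => [] [] | rewrite h].
- by move/eqP/negbTE: ip => ->; rewrite h.
Qed.

(** A pair straddling the cut would have left end [T - 1], but left ends have parity [p], the parity
    of [T]. *)
Lemma chain_partner_cut n p T i : odd T = p ->
  (T <= chain_partner n p i)%N = (T <= i)%N.
Proof.
move=> Tp; rewrite /chain_partner; case: (odd i =P p) => ip; case: ifP => // h.
- rewrite leq_eqVlt ltnS orb_idl // => /eqP Ti.
  by move: Tp; rewrite Ti /= ip; case: (p).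
- case: i ip h => //= i ip _; rewrite [RHS]leq_eqVlt ltnS orb_idl // => /eqP Ti.
  by move: Tp ip; rewrite Ti /= => ->.
Qed.

Section Chain.

Variables (n d : nat) (c mu del : R).
Hypotheses (n_ge2 : (1 < n)%N) (nd : (n <= d)%N).
Hypotheses (c_ge0 : 0 <= c) (mu_gt0 : 0 < mu) (del_gt0 : 0 < del).

Definition partner (p : bool) (i : 'I_d) : 'I_d := insubd i (chain_partner n p i).

Lemma val_partner p i : partner p i = chain_partner n p i :> nat.
Proof. by rewrite /partner val_insubd chain_partner_lt. Qed.

Lemma partnerK p : involutive (partner p).
Proof. by move=> i; apply: val_inj; rewrite /= !val_partner chain_partnerK. Qed.

Definition chain_linear (p : bool) : vec d :=
  fun i => if p && (i == 0 :> nat)%N then - c else 0.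

Definition chain p := paired (partner p) (chain_linear p) c mu del.

Notation chain_grad p := (paired_grad (partner p) (chain_linear p) c mu del).

Lemma chain_sandwich p :
  quadratic_sandwich mu (2 * c / del + mu / 2) (chain p) (chain_grad p).
Proof. by apply: paired_sandwich => //; apply: partnerK. Qed.

(** Without the quadratic part, the gradient has entries of size at most [c] on the first [n]
    coordinates and 0 elsewhere: coordinate 0 is unpaired for odd parity, so its linear term stands
    alone. The quadratic part adds at most [mu] on the ball. *)
Lemma chain_grad_norm p w L :
  in_ball w -> 0 <= L - mu -> INR n * c ^ 2 <= (L - mu) ^ 2 ->
  norm (chain_grad p w) <= L.
Proof.
move=> wb L0 nc.
pose q : vec d := fun i =>
  chain_linear p i + c * smooth_sign del (w i - w (partner p i)).
have -> : chain_grad p w = vadd q (vscale mu w) by [].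
apply: Rle_trans (norm_triangle _ _) _.
rewrite norm_vscale Rabs_pos_eq; last lra.
suff : norm q <= L - mu by move: wb; rewrite /in_ball; nra.
apply/norm_leP => //; apply: Rle_trans nc; rewrite -(rsum_const_prefix (c ^ 2) nd).
apply: rsum_le => i.
have -> : q i * q i = q i ^ 2 by ring.
have fixed : partner p i = i -> q i = chain_linear p i.
  by move=> fi; rewrite /q fi Rminus_diag smooth_sign0; ring.
have [i0|i0] := boolP (p && (i == 0 :> nat)%N).
  have fi : partner p i = i.
    apply: val_inj; rewrite /= val_partner /chain_partner.
    by case/andP: i0 => -> /eqP ->.
  rewrite (fixed fi) /chain_linear i0; case/andP: i0 => _ /eqP ->.
  by rewrite (ltnW n_ge2); right; ring.
have qE : q i = c * smooth_sign del (w i - w (partner p i)).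
  by rewrite /q /chain_linear (negbTE i0); ring.
case: ifP => ni.
  rewrite qE Rpow_mult_distr.
  have := smooth_sign_sq_le1 del_gt0 (w i - w (partner p i)).
  by have := pow2_ge_0 c; nra.
have fi : partner p i = i.
  apply: val_inj; rewrite /= val_partner /chain_partner ni andbF.
  by rewrite (leq_gtF (n := i.+1)) ?if_same // ltnW // ltnS leqNgt ni.
by rewrite (fixed fi) /chain_linear (negbTE i0); right; ring.
Qed.

(* A subgradient of [sum_(i + 1 < n) |w_i - w_(i+1)|], restricted to the pairs
   of parity [p]; over both parities it telescopes to [w_0 - w_(n-1)]. *)
Definition chain_slope (p : bool) (i : nat) : R :=
  if odd i == p then (if (i.+1 < n)%N then 1 else 0)
  else (if (0 < i < n)%N then -1 else 0).

Lemma chain_slope_partner p i : chain_slope p (chain_partner n p i) = - chain_slope p i.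
Proof.
rewrite /chain_partner /chain_slope; case: (odd i =P p) => ip;
  [case h: (i.+1 < n)%N | case h: (0 < i < n)%N].
- by rewrite /= -ip; case: (odd i); rewrite /= h.
- by rewrite ip eqxx h; ring.
- case: i ip h => //= i ip /= h.
  by have -> : odd i == p; [case: (odd i) p ip {h} => [] [] | rewrite h; ring].
- by move/eqP/negbTE: ip => ->; rewrite h; ring.
Qed.

Lemma chain_slope_sum i : (i.+1 < n)%N ->
  chain_slope true i + chain_slope false i = if i == 0%N then 1 else 0.
Proof.
move=> h; have h' := ltnW h; rewrite /chain_slope h h'.
by case: i h h' => [|i] h h' /=; [lra | case: (odd i) => /=; lra].
Qed.

Lemma chain_abs_sum_ge p (w : vec d) :
  2 * rsum (fun i => chain_slope p i * w i) <=
    rsum (fun i => smooth_abs del (w i - w (partner p i))).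
Proof.
rewrite -(rsum_odd_pairing (partnerK p)); last first.
  by move=> i; rewrite val_partner chain_slope_partner.
apply: rsum_le => i; apply: smooth_abs_ge_mul => //.
by rewrite /chain_slope; do 2!case: ifP => _; lra.
Qed.

(** Since [w_(n-1) = 0], the slopes bound the chain terms below by [c * w_0], which offsets the
    linear term. *)
Lemma chain_sum_ge0 w : below n.-1 w -> 0 <= chain true w + chain false w.
Proof.
move=> wn; rewrite /chain /paired.
have := chain_abs_sum_ge true w; have := chain_abs_sum_ge false w.
have slopes : c * (rsum (fun i : 'I_d => chain_slope true i * w i) +
    rsum (fun i : 'I_d => chain_slope false i * w i)) = - dot (chain_linear true) w.
  rewrite -rsum_add -rsum_scale /dot.
  have -> : - rsum (fun i => chain_linear true i * w i) =
    -1 * rsum (fun i => chain_linear true i * w i) by ring.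
  rewrite -rsum_scale; apply: rsum_ext => i; rewrite /chain_linear /=.
  have [ni|ni] := leqP n.-1 i; first by rewrite wn //; ring.
  have := @chain_slope_sum i; rewrite -ltn_predRL => /(_ ni) h.
  have -> : c * (chain_slope true i * w i + chain_slope false i * w i) =
    c * ((chain_slope true i + chain_slope false i) * w i) by ring.
  by rewrite h; case: ifP => _; ring.
have -> : dot (chain_linear false) w = 0.
  rewrite /dot (@rsum_ext _ _ (fun=> 0)) ?rsum0 // => i.
  by rewrite /chain_linear /=; ring.
have := dot_ge0 w; move: slopes.
set S1 := rsum (fun i => chain_slope true i * _).
set S2 := rsum (fun i => chain_slope false i * _).
set A1 := rsum (fun i => smooth_abs _ (_ - w (partner true _))).
set A2 := rsum _; set D := dot (chain_linear true) w => slopes w0 h1 h2.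
have c2 : 0 <= c / 2 by lra.
have := Rmult_le_compat_l _ _ _ c2 h1; have := Rmult_le_compat_l _ _ _ c2 h2.
by have := Rmult_le_pos _ _ (Rlt_le _ _ mu_gt0) w0; lra.
Qed.

Definition plateau beta : vec d := fun i => if (i < n)%N then beta else 0.

Lemma plateau_sq beta : dot (plateau beta) (plateau beta) = INR n * beta ^ 2.
Proof.
rewrite -(rsum_const_prefix (beta ^ 2) nd); apply: rsum_ext => i.
by rewrite /plateau; case: ifP => _; ring.
Qed.

(** Partners lie on the same side of [n], so every difference is 0; each of the [d] smoothed terms
    still costs [del], fixed points included. *)
Lemma chain_sum_plateau beta :
  chain true (plateau beta) + chain false (plateau beta) =
    - c * beta + c * (INR d * del) + mu * (INR n * beta ^ 2).
Proof.
have flat p : rsum (fun i => smooth_abs del (plateau beta i - plateau beta (partner p i))) =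
    INR d * del.
  rewrite -rsum_const; apply: rsum_ext => i.
  have -> : plateau beta (partner p i) = plateau beta i.
    rewrite /plateau val_partner /chain_partner.
    case: (odd i == p); [case: (boolP (i.+1 < n)%N) | case: (boolP (0 < i < n)%N)] => //.
      by move=> h; rewrite h (ltnW h).
    by case/andP=> i0 h; rewrite h (leq_ltn_trans (leq_pred i) h).
  by rewrite Rminus_diag smooth_abs0.
rewrite /chain /paired !flat plateau_sq.
have d0 : (0 < d)%N by apply: leq_trans nd; apply: ltnW.
have -> : dot (chain_linear true) (plateau beta) = - c * beta.
  rewrite /dot (@rsum_single _ (Ordinal d0)).
    by rewrite /chain_linear /plateau /= (ltnW n_ge2).
  move=> i i0; rewrite /chain_linear /=; case: eqP => ii; last ring.
  by case: i0; apply: val_inj.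
have -> : dot (chain_linear false) (plateau beta) = 0.
  rewrite /dot (@rsum_ext _ _ (fun=> 0)) ?rsum0 // => i.
  by rewrite /chain_linear /=; ring.
by field.
Qed.

(** One of [T] and [T + 1] has parity [p], and no pair of that matching straddles the corresponding
    cut. *)
Lemma chain_local_reach p T W W' :
  (forall w, In w W -> below T w) -> local_reach (chain p) W W' ->
  forall w, In w W' -> below T.+1 w.
Proof.
move=> WT.
have step T' : (T <= T')%N -> odd T' = p -> local_reach (chain p) W W' ->
    forall w, In w W' -> below T' w.
  move=> TT Tp; apply: local_reach_below => //.
  - exact: partnerK.
  (* For odd parity [T'] is positive, so the linear term at coordinate 0 lies below the cut. *)
  - move=> i iT; rewrite /chain_linear; case: p Tp => //= Tp.
    by case: eqP => // i0; move: iT; rewrite i0 leqn0 => /eqP T0; rewrite T0 in Tp.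
  - by move=> i; rewrite val_partner chain_partner_cut.
  - by move=> w /WT; apply: below_le.
have [Tp|Tp] := boolP (odd T == p).
  move=> H w wW; apply: (@below_le _ T) => //.
  exact: (step T (leqnn T) (eqP Tp) H).
apply: step => //=; by case: (odd T) p Tp => [] [].
Qed.

Lemma chain_reach m (holds : 'I_m -> bool) T S j :
  reach (fun i => if holds i then chain true else chain false) T S ->
  forall w, In w (S j) -> below T w.
Proof.
move=> H; elim: H j => {T S} [|T S S' _ IH hS] j w.
  by move=> [<-|[]] i _.
rewrite /= => wS.
have {wS} [k wS'] : exists k, In w (S' k).
  elim: (enum 'I_m) wS => [//|k s IHs] /=.
  by rewrite in_app_iff => -[wk|/IHs //]; exists k.
have : local_reach (chain (holds k)) (S k) (S' k).
  by have := hS k; case: (holds k).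
by move/(chain_local_reach (IH k)); apply.
Qed.

End Chain.

(** * Choice of the parameters *)

Lemma nat_floor q : 2 <= q -> exists n : nat, (1 < n)%N /\ q - 1 <= INR n <= q.
Proof.
move=> q2; have [h1 h2] := archimed q.
have u3 : (2 < up q)%Z by apply: lt_IZR; lra.
exists (Z.to_nat (up q - 1)); split; first by apply/ltP; lia.
by rewrite INR_IZR_INZ Z2Nat.id ?minus_IZR; [lra | lia].
Qed.

Lemma convex_of_strongly_convex d mu (F : vec d -> R) :
  0 <= mu -> strongly_convex_on_ball mu F -> convex_on_ball F.
Proof.
move=> mu0 Fsc u v t ub vb ht; have := Fsc u v t ub vb ht.
have : 0 <= mu / 2 * t * (1 - t) * norm (vsub u v) ^ 2.
  rewrite norm_sq; apply: Rmult_le_pos (dot_ge0 _).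
  by do 2!(apply: Rmult_le_pos; last lra); lra.
lra.
Qed.

Lemma strongly_convex_avg d mu (F1 F2 : vec d -> R) :
  strongly_convex_on_ball mu F1 -> strongly_convex_on_ball mu F2 ->
  strongly_convex_on_ball mu (fun w => (F1 w + F2 w) / 2).
Proof.
move=> h1 h2 u v t ub vb ht.
by have := h1 u v t ub vb ht; have := h2 u v t ub vb ht; lra.
Qed.

Lemma lipschitz_avg d L (F1 F2 : vec d -> R) :
  lipschitz_on_ball L F1 -> lipschitz_on_ball L F2 ->
  lipschitz_on_ball L (fun w => (F1 w + F2 w) / 2).
Proof.
move=> h1 h2 u v ub vb.
have -> : (F1 u + F2 u) / 2 - (F1 v + F2 v) / 2 =
  (F1 u - F1 v) / 2 + (F2 u - F2 v) / 2 by field.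
apply: Rle_trans (Rabs_triang _ _) _.
rewrite /Rdiv !Rabs_mult (Rabs_pos_eq (/ 2)); last lra.
by have := h1 u v ub vb; have := h2 u v ub vb; lra.
Qed.

(* The last bound is the suboptimality of every vector with [w_(n-1) = 0],
   up to the smoothing error. *)
Definition hard_parameters (lam eps : R) (n : nat) (c mu beta : R) : Prop :=
  [/\ (1 < n)%N, 0 <= c, 0 < mu & lam <= mu] /\
  [/\ 0 <= 1 + lam - mu, INR n * c ^ 2 <= (1 + lam - mu) ^ 2,
      INR n * beta ^ 2 <= 1 &
      eps < (c * beta - mu * (INR n * beta ^ 2)) / 2].

Lemma hard_parameters_convex eps : 0 < eps < 1 / 16 ->
  exists n c mu beta, hard_parameters 0 eps n c mu beta /\
    1 / (8 * eps) - 2 <= INR n.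
Proof.
move=> [e0 e1]; pose q := 1 / (8 * eps).
have qe : q * (8 * eps) = 1 by rewrite /q; field; lra.
have q2 : 2 <= q by nra.
have [n [n1 [nlo nhi]]] := nat_floor q2.
have n0 : 0 < INR n by lra.
have s0 := sqrt_lt_R0 _ n0; have ss : sqrt (INR n) ^ 2 = INR n by rewrite pow2_sqrt; lra.
(* With regularization [mu = eps], [c] exhausts the Lipschitz budget and [beta] reaches the unit
   sphere. The gap is [((1 - eps) / n - eps) / 2], where [1 / n >= 8 * eps]. *)
exists n, ((1 - eps) / sqrt (INR n)), eps, (1 / sqrt (INR n)).
have h1 : INR n * ((1 - eps) / sqrt (INR n)) ^ 2 = (1 - eps) ^ 2.
  by rewrite -{1}ss; field; lra.
have h2 : INR n * (1 / sqrt (INR n)) ^ 2 = 1 by rewrite -{1}ss; field; lra.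
have h3 : (1 - eps) / sqrt (INR n) * (1 / sqrt (INR n)) = (1 - eps) / INR n.
  by rewrite -[in RHS]ss; field; lra.
split; last by rewrite -/q; lra.
split; split=> //; rewrite ?h1 ?h2 ?h3; try lra.
- by apply: Rmult_le_pos; [lra | apply/Rlt_le/Rinv_0_lt_compat].
- have : 8 * eps * (1 - eps) <= (1 - eps) / INR n; last by nra.
  rewrite /Rdiv Rmult_comm; apply: Rmult_le_compat_l; first lra.
  by apply: (Rmult_le_reg_l (INR n)) => //; rewrite Rinv_r; [nra | lra].
Qed.

Lemma hard_parameters_strongly_convex lam eps :
  0 < lam -> 0 < eps < 1 / (16 * lam * (3 + 1 / (2 * lam)) ^ 2) ->
  exists n c mu beta, hard_parameters lam eps n c mu beta /\
    sqrt (1 / (16 * lam * eps)) - 2 <= INR n.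
Proof.
(* The bound on [eps] gives [q >= Q], hence [n >= 1 / (2 * lam)], which places the plateau in the
   ball. *)
move=> l0; set Q := 3 + 1 / (2 * lam) => -[e0 e1].
have l2 : 0 < 1 / (2 * lam) by apply: Rdiv_lt_0_compat; lra.
have Q3 : 3 < Q by rewrite /Q; lra.
have le0 : 0 < 16 * lam * eps by nra.
pose q := sqrt (1 / (16 * lam * eps)).
have qq : q ^ 2 * (16 * lam * eps) = 1.
  by rewrite /q pow2_sqrt; [field; lra | apply/Rlt_le/Rdiv_lt_0_compat; lra].
have q0 : 0 <= q by apply: sqrt_pos.
have qQ : Q <= q.
  have lQ : 0 < 16 * lam * Q ^ 2 by apply: Rmult_lt_0_compat; [lra | apply: pow_lt; lra].
  have := Rmult_lt_compat_l _ _ _ lQ e1.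
  have -> : 16 * lam * Q ^ 2 * (1 / (16 * lam * Q ^ 2)) = 1 by field; split; lra.
  move=> h; apply: Rnot_lt_le => qltQ.
  have qQ2 : q ^ 2 <= Q ^ 2 by apply: pow_incr; lra.
  by have := Rmult_le_compat_r _ _ _ (Rlt_le _ _ le0) qQ2; lra.
have q2 : 2 <= q by lra.
have [n [n1 [nlo nhi]]] := nat_floor q2.
have n0 : 0 < INR n by lra.
have s0 := sqrt_lt_R0 _ n0; have ss : sqrt (INR n) ^ 2 = INR n by rewrite pow2_sqrt; lra.
pose c := 1 / sqrt (INR n).
have cc : INR n * c ^ 2 = 1 by rewrite /c -{1}ss; field; lra.
have c0 : 0 < c by apply: Rdiv_lt_0_compat; lra.
(* This [beta] maximizes [c * beta - lam * n * beta ^ 2]; the gap becomes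
   [1 / (8 * lam * n ^ 2) >= 2 * eps]. *)
exists n, c, lam, (c / (2 * lam * INR n)).
have h1 : c * (c / (2 * lam * INR n)) = 1 / (2 * lam * INR n ^ 2).
  by rewrite -[X in X / (2 * lam * INR n ^ 2)]cc; field; lra.
have h2 : INR n * (c / (2 * lam * INR n)) ^ 2 = 1 / (2 * lam * INR n) ^ 2.
  by rewrite -[X in X / (2 * lam * INR n) ^ 2]cc; field; lra.
split; last by rewrite -/q; lra.
split; split=> //; rewrite ?cc ?h1 ?h2; try lra.
- have ln : 1 <= 2 * lam * INR n.
    have -> : 1 = 2 * lam * (1 / (2 * lam)) by field; lra.
    by apply: Rmult_le_compat_l; [lra | rewrite /Q in qQ; lra].
  apply: (Rmult_le_reg_r ((2 * lam * INR n) ^ 2)); first by nra.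
  by rewrite /Rdiv Rmult_assoc Rinv_l; nra.
- have -> : (1 / (2 * lam * INR n ^ 2) - lam * (1 / (2 * lam * INR n) ^ 2)) / 2 =
    1 / (8 * lam * INR n ^ 2) by field; lra.
  have nq : INR n ^ 2 <= q ^ 2 by apply: pow_incr; lra.
  have ln : 0 < 8 * lam * INR n ^ 2 by apply: Rmult_lt_0_compat; [lra | apply: pow_lt].
  apply: (Rmult_lt_reg_r (8 * lam * INR n ^ 2)) => //.
  have -> : 1 / (8 * lam * INR n ^ 2) * (8 * lam * INR n ^ 2) = 1 by field; split; lra.
  by have := Rmult_le_compat_l _ _ _ (Rlt_le _ _ le0) nq; nra.
Qed.

Lemma hard_parameters_exist lam : 0 <= lam ->
  exists eps0, 0 < eps0 /\ forall eps, 0 < eps < eps0 ->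
    exists n c mu beta, hard_parameters lam eps n c mu beta /\
      (lam = 0 -> 1 / (8 * eps) - 2 <= INR n) /\
      (0 < lam -> sqrt (1 / (16 * lam * eps)) - 2 <= INR n).
Proof.
move=> [l0|<-].
  exists (1 / (16 * lam * (3 + 1 / (2 * lam)) ^ 2)); split.
    have l2 : 0 < 1 / (2 * lam) by apply: Rdiv_lt_0_compat; lra.
    by apply: Rdiv_lt_0_compat; [lra | apply: Rmult_lt_0_compat; [lra | apply: pow_lt; lra]].
  move=> eps /(hard_parameters_strongly_convex l0) [n [c [mu [beta [h hn]]]]].
  by exists n, c, mu, beta; split=> //; split=> // h0; lra.
exists (1 / 16); split; first lra.
move=> eps /hard_parameters_convex [n [c [mu [beta [h hn]]]]].
by exists n, c, mu, beta; split=> //; split=> // h0; lra.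
Qed.

(** * The lower bound on rounds *)

Lemma chain_lower_bound lam eps n c mu beta d :
  hard_parameters lam eps n c mu beta -> (n <= d)%N ->
  exists F1 F2 : vec d -> R,
    convex_on_ball F1 /\ convex_on_ball F2 /\
    strongly_convex_on_ball lam F1 /\ strongly_convex_on_ball lam F2 /\
    lipschitz_on_ball (1 + lam) F1 /\ lipschitz_on_ball (1 + lam) F2 /\
    exists wstar : vec d,
      in_ball wstar /\
      (forall u, in_ball u -> (F1 wstar + F2 wstar) / 2 <= (F1 u + F2 u) / 2) /\
      forall m (holds : 'I_m -> bool) (T : nat) (S : 'I_m -> list (vec d))
        (j : 'I_m) (what : vec d),
        reach (fun i => if holds i then F1 else F2) T S ->
        span_of (fun v => In v (S j)) what ->
        (F1 what + F2 what) / 2 - (F1 wstar + F2 wstar) / 2 <= eps ->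
        (n <= T)%N.
Proof.
move=> [[n1 c0 mu0 lam_mu] [L0 nc nb gap]] nd.
pose M := (c * beta - mu * (INR n * beta ^ 2)) / 2 - eps.
have M0 : 0 < M by rewrite /M; lra.
have cd0 : 0 <= c * INR d by apply: Rmult_le_pos => //; apply: pos_INR.
(* The smoothing cost [c * d * del] stays within the slack [M]; the [+ 1] keeps the denominator
   positive. *)
pose del := M / (c * INR d + 1).
have del0 : 0 < del by apply: Rdiv_lt_0_compat; lra.
have cdM : c * (INR d * del) <= M.
  have -> : c * (INR d * del) = M - del by rewrite /del; field; lra.
  lra.
pose F p := @chain n d c mu del p.
have sandwich p := @chain_sandwich n d c mu del nd c0 del0 p.
have sc lam' : lam' <= mu -> forall p, strongly_convex_on_ball lam' (F p).
  by move=> h p; apply: (sandwich_strongly_convex (sandwich p)).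
have cv p : convex_on_ball (F p).
  by apply: (convex_of_strongly_convex (Rlt_le _ _ mu0)); apply: sc; lra.
have lip p : lipschitz_on_ball (1 + lam) (F p).
  by apply: (sandwich_lipschitz mu0 (sandwich p)) => w wb; apply: chain_grad_norm.
have [wstar [wb wmin]] := strongly_convex_min_exists mu0
  (strongly_convex_avg (sc mu (Rle_refl _) true) (sc mu (Rle_refl _) false))
  (lipschitz_avg (lip true) (lip false)).
have scl := sc lam lam_mu.
exists (F true), (F false); do 6!split=> //.
exists wstar; do 2!split=> //.
move=> m holds T S j what hS hspan hgap.
(* With fewer than [n] rounds the output has a nonnegative value, whereas the plateau value is below
   [- eps]. *)
rewrite leqNgt; apply/negP => Tn.
have whatT : below n.-1 what.
  apply: span_below hspan => w wS; apply: (@below_le _ T); first by rewrite -ltnS prednK // ltnW.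
  exact: (chain_reach nd c0 mu0 del0 hS wS).
have pb : in_ball (plateau n beta : vec d).
  by apply/in_ballP; rewrite plateau_sq.
have := wmin _ pb; have := chain_sum_ge0 nd c0 mu0 del0 whatT.
have := chain_sum_plateau c mu n1 nd del0 beta.
rewrite /F in hgap *; rewrite /M in M0 cdM; lra.
Qed.

Theorem theorem2 :
  forall m : nat, (0 < m)%N -> ~~ odd m ->
  forall lam : R, 0 <= lam ->
  exists eps0 : R, 0 < eps0 /\
  forall eps : R, 0 < eps < eps0 ->
  exists d0 : nat, forall d : nat, (d0 <= d)%N ->
  exists F1 F2 : vec d -> R,
    convex_on_ball F1 /\ convex_on_ball F2 /\
    strongly_convex_on_ball lam F1 /\ strongly_convex_on_ball lam F2 /\
    lipschitz_on_ball (1 + lam) F1 /\ lipschitz_on_ball (1 + lam) F2 /\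
    exists wstar : vec d,
      in_ball wstar /\
      (forall u, in_ball u -> (F1 wstar + F2 wstar) / 2 <= (F1 u + F2 u) / 2) /\
      forall holds : 'I_m -> bool, #|[pred i | holds i]| = m./2 ->
      forall (T : nat) (S : 'I_m -> list (vec d)) (j : 'I_m) (what : vec d),
        reach (fun i => if holds i then F1 else F2) T S ->
        span_of (fun v => In v (S j)) what -> in_ball what ->
        (F1 what + F2 what) / 2 - (F1 wstar + F2 wstar) / 2 <= eps ->
        (lam = 0 -> INR T >= 1 / (8 * eps) - 2) /\
        (0 < lam -> INR T >= sqrt (1 / (16 * lam * eps)) - 2).
Proof.
move=> m _ _ lam lam0.
have [eps0 [eps0_gt0 params]] := hard_parameters_exist lam0.
exists eps0; split=> // eps /params [n [c [mu [beta [hard [n_cvx n_scvx]]]]]].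
exists n => d nd; have [F1 [F2 [? [? [? [? [? [? [w [? [? rounds]]]]]]]]]]] :=
  chain_lower_bound hard nd.
exists F1, F2; do 6!split=> //; exists w; do 2!(split=> //).
move=> holds _ T S j what hS hspan _ hgap.
have /leP/le_INR nT := rounds m holds T S j what hS hspan hgap.
by split=> h; apply/Rle_ge/(Rle_trans _ _ _ _ nT); [apply: n_cvx | apply: n_scvx].
Qed.
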